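(* Let $\mathcal{I}$ and $\mathcal{J}$ be $F_\sigma$ ideals on $\mathbb{N}$ such that $\mathcal{I}\leq_{RK}\mathcal{J}$. If $\mathcal{J}$ is nonpathological, then $\mathcal{I}$ is nonpathological.
   Context: An ideal on $\mathbb{N}$ is a family of subsets of $\mathbb{N}$ closed under subsets and finite unions, not containing $\mathbb{N}$, and containing all finite subsets of $\mathbb{N}$; $F_\sigma$ refers to the topology of $2^{\mathbb{N}}$. $\mathcal{I}\leq_{RK}\mathcal{J}$ (Rudin-Keisler order) means that there is $f:\mathbb{N}\to\mathbb{N}$ with $\mathcal{I}=\{A\subseteq\mathbb{N}:f^{-1}(A)\in\mathcal{J}\}$. A lower semicontinuous submeasure (lscsm) on $\mathbb{N}$ is a function $\varphi:\mathcal{P}(\mathbb{N})\to[0,\infty]$ with $\varphi(\emptyset)=0$, $\varphi(A)\leq\varphi(A\cup B)\leq\varphi(A)+\varphi(B)$, $\varphi(\{n\})<\infty$ for all $n$, and $\varphi(A)=\lim_{n\to\infty}\varphi(A\cap\{0,1,\dots,n\})$. Put $\mathrm{FIN}(\varphi)=\{A\subseteq\mathbb{N}:\varphi(A)<\infty\}$. A lscsm $\varphi$ is nonpathological if $\varphi(A)=\sup\{\mu(A):\mu\text{ is a }\sigma\text{-additive measure on }\mathcal{P}(\mathbb{N})\text{ with }\mu\leq\varphi\}$ for all $A\subseteq\mathbb{N}$. An $F_\sigma$ ideal is nonpathological if it equals $\mathrm{FIN}(\varphi)$ for some nonpathological lscsm $\varphi$. *)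

(* Defs.v *)
From mathcomp Require Import all_boot all_order all_algebra.
From mathcomp Require Import all_classical all_reals all_analysis.
From mathcomp Require Import borel_hierarchy.

Set Implicit Arguments.
Unset Strict Implicit.
Unset Printing Implicit Defensive.

Import numFieldNormedType.Exports.

Local Open Scope classical_set_scope.
Local Open Scope ring_scope.
Local Open Scope ereal_scope.

Record is_ideal (I : set_system nat) : Prop := IsIdeal {
  ideal_subset : forall A B : set nat, A `<=` B -> I B -> I A;
  ideal_setU : forall A B : set nat, I A -> I B -> I (A `|` B);
  ideal_proper : ~ I [set: nat];
  ideal_finite : forall A : set nat, finite_set A -> I A
}.

(* A point x of the Cantor space (the topological space 2^N) stands
   for the subset of nat whose indicator function is x. *)
Definition is_Fsigma_family (I : set_system nat) : Prop :=
  Fsigma [set x : cantor_space | I [set n : nat | x n]].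

Definition is_Fsigma_ideal (I : set_system nat) : Prop :=
  is_ideal I /\ is_Fsigma_family I.

Definition RK_le (I J : set_system nat) : Prop :=
  exists f : nat -> nat, I = [set A : set nat | J (f @^-1` A)].

Record is_lscsm (R : realType) (phi : set nat -> \bar R) : Prop := IsLscsm {
  lscsm_ge0 : forall A : set nat, 0 <= phi A;
  lscsm_set0 : phi set0 = 0;
  lscsm_le_setU : forall A B : set nat, phi A <= phi (A `|` B);
  lscsm_setU_le : forall A B : set nat, phi (A `|` B) <= phi A + phi B;
  lscsm_set1_lty : forall n : nat, phi [set n] < +oo;
  lscsm_cvg : forall A : set nat,
    phi (A `&` [set k : nat | (k <= n)%N]) @[n --> \oo] --> phi A
}.

Definition FIN (R : realType) (phi : set nat -> \bar R) : set_system nat :=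
  [set A : set nat | phi A < +oo].

(* Every subset of nat is measurable for the library's sigma-algebra on nat. *)
Definition dominated_measures (R : realType) (phi : set nat -> \bar R) :
    set {measure set nat -> \bar R} :=
  [set mu : {measure set nat -> \bar R} | forall B : set nat, mu B <= phi B].

Definition nonpathological_lscsm (R : realType) (phi : set nat -> \bar R) :
    Prop :=
  is_lscsm phi /\
  forall A : set nat, phi A = ereal_sup [set mu A | mu in dominated_measures phi].

Definition nonpathological (R : realType) (I : set_system nat) : Prop :=
  is_Fsigma_ideal I /\
  exists2 phi : set nat -> \bar R, nonpathological_lscsm phi & I = FIN phi.

(* Main.v *)
Require Import Defs.
From mathcomp Require Import all_boot all_order all_algebra.
From mathcomp Require Import all_classical all_reals all_analysis.

(** If [I] is the image of [J] under [f] and [J = FIN phi], then [I = FIN psi]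
    for the image submeasure [psi A = phi (f @^-1` A)].  Since [f] may have
    infinite fibres, it is not automatic that [psi] is finite on singletons;
    this holds because the ideal [I] contains the finite sets, so that the
    fibres of [f] belong to [J].  Two points remain: [psi] is again lower
    semicontinuous ([is_lscsm_preimage]), and it is again a supremum of
    measures ([nonpathological_lscsm_preimage]).  For the second one, a measure
    [mu <= phi] is pushed forward along [f] to a measure below [psi], whose
    value at [A] is [mu (f @^-1` A)]; these values already have supremum
    [phi (f @^-1` A) = psi A]. *)

Set Implicit Arguments.
Unset Strict Implicit.
Unset Printing Implicit Defensive.

Import Order.TTheory.

Local Open Scope classical_set_scope.
Local Open Scope ring_scope.
Local Open Scope ereal_scope.

Lemma lscsm_mono (R : realType) (phi : set nat -> \bar R) (A B : set nat) :
  is_lscsm phi -> A `<=` B -> phi A <= phi B.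
Proof. by move=> hphi /setUidPr <-; exact: lscsm_le_setU. Qed.

Lemma sub_preimage_initial_segment (f : nat -> nat) (m : nat) :
  exists n, [set k | (k <= m)%N] `<=` f @^-1` [set k | (k <= n)%N].
Proof.
exists (\max_(i < m.+1) f i)%N => k /= km.
exact: (leq_bigmax (Ordinal (km : (k < m.+1)%N))).
Qed.

(** For lower semicontinuity, the sets [f @^-1` [set k | k <= n]] increase
    with [n], and each initial segment [[set k | k <= m]] is contained in one
    of them; hence the values of [phi] on their traces on [f @^-1` A] are
    eventually squeezed between [phi (f @^-1` A `&` [set k | k <= m])] and
    [phi (f @^-1` A)]. *)
Lemma is_lscsm_preimage (R : realType) (phi : set nat -> \bar R)
    (f : nat -> nat) :
  is_lscsm phi -> (forall n, phi (f @^-1` [set n]) < +oo) ->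
  is_lscsm (fun A => phi (f @^-1` A)).
Proof.
move=> hphi fin_fibre; split => //.
- by move=> A; exact: lscsm_ge0.
- by rewrite preimage_set0; exact: lscsm_set0.
- by move=> A B; rewrite preimage_setU; exact: lscsm_le_setU.
- by move=> A B; rewrite preimage_setU; exact: lscsm_setU_le.
move=> A.
pose u n := phi (f @^-1` (A `&` [set k | (k <= n)%N])).
have u_nd : nondecreasing_seq u.
  move=> n p np; apply: lscsm_mono => // k [Ak kn]; split => //=.
  exact: leq_trans kn np.
suff -> : phi (f @^-1` A) = ereal_sup (range u).
  exact: ereal_nondecreasing_cvgn.
apply/eqP; rewrite eq_le; apply/andP; split; last first.
  by apply: ge_ereal_sup => _ [n _ <-]; apply: lscsm_mono => // k [].
have phi_cvg : phi (f @^-1` A `&` [set k | (k <= m)%N]) @[m --> \oo] -->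
    phi (f @^-1` A) by exact: (lscsm_cvg hphi).
rewrite -(cvg_lim (@ereal_hausdorff R) phi_cvg).
apply: lime_le; first by apply/cvg_ex; exists (phi (f @^-1` A)).
apply: nearW => m; have [n mn] := sub_preimage_initial_segment f m.
apply: (@le_trans _ _ (u n)); last by apply: ereal_sup_ubound; exists n.
by apply: lscsm_mono => // k [Ak km]; split => //; exact: mn.
Qed.

Lemma nonpathological_lscsm_preimage (R : realType) (phi : set nat -> \bar R)
    (f : nat -> nat) :
  nonpathological_lscsm phi -> (forall n, phi (f @^-1` [set n]) < +oo) ->
  nonpathological_lscsm (fun A => phi (f @^-1` A)).
Proof.
move=> [hphi phiE] fin_fibre; split; first exact: is_lscsm_preimage.
move=> A; apply/eqP; rewrite eq_le; apply/andP; split; last first.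
  by apply: ge_ereal_sup => _ [nu nu_le <-]; exact: nu_le.
rewrite [leLHS]phiE; apply: ge_ereal_sup => _ [mu mu_le <-].
have [nu nuE] : exists nu : {measure set nat -> \bar R},
    forall B, nu B = mu (f @^-1` B).
  (* The shelved goal is the measurability of f, which is immediate because
     every set of natural numbers is measurable. *)
  by unshelve refine
    (ex_intro _ (pushforward mu f : {measure set nat -> \bar R}) _).
apply: ereal_sup_ubound; exists nu => [B|]; last exact: nuE.
by rewrite nuE; exact: mu_le.
Qed.

Theorem theorem3p12 (R : realType) (I J : set_system nat)
    (hI : is_Fsigma_ideal I) (hJ : is_Fsigma_ideal J) (hIJ : RK_le I J) :
  nonpathological R J -> nonpathological R I.
Proof.
move=> [_ [phi phi_np JE]]; split => //.
case: hIJ => f IE.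
exists (fun A => phi (f @^-1` A)); last by rewrite IE JE.
apply: nonpathological_lscsm_preimage => // n.
have : I [set n] by apply: (ideal_finite hI.1); exact: finite_set1.
by rewrite IE JE.
Qed.
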